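(* Let $\Gamma$ be a finite simple graph and $k\ge0$ an integer. Then $-1$ is an eigenvalue of $A(\Gamma)$ of multiplicity $k$ (multiplicity $0$ meaning $-1$ is not an eigenvalue) if and only if $k=|V(\Gamma)|-\mathrm{rank}(I+A(S\Omega(\Gamma)))$.
   Context: $A(G)$ denotes the adjacency matrix of a graph $G$; rank is over the reals. For a graph $\Gamma$, consider partitions of $V(\Gamma)$ into nonempty parts such that each part induces a complete subgraph and, for any two distinct parts $P,Q$, either every vertex of $P$ is adjacent to every vertex of $Q$ or no vertex of $P$ is adjacent to any vertex of $Q$. The complete skeleton $\Omega(\Gamma)$ is such a partition with the minimum number of parts; its structure $S\Omega(\Gamma)$ is the simple graph whose vertices are the parts, two parts being adjacent iff they are completely joined. *)

(* Defs.v *)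
From mathcomp Require Import all_boot all_order all_algebra reals.

Set Implicit Arguments.
Unset Strict Implicit.
Unset Printing Implicit Defensive.

Import GRing.Theory.
Local Open Scope ring_scope.

Record sgraph := SGraph {
  vertex :> finType;
  adj : rel vertex;
  adj_sym : symmetric adj;
  adj_irr : irreflexive adj }.

(* The vertices are indexed by 'I_#|G| along the enumeration of the finType;
   another enumeration only conjugates the matrix by a permutation. *)
Definition adjmx (R : realType) (G : sgraph) : 'M[R]_#|G| :=
  \matrix_(i, j) (adj (enum_val i) (enum_val j))%:R.

(* Algebraic multiplicity, i.e. the multiplicity of a as a root of the
   characteristic polynomial; it is 0 exactly when a is not an eigenvalue. *)
Definition eigen_multiplicity (R : realType) (n : nat) (A : 'M[R]_n) (a : R) :
  nat := mup a (char_poly A).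

Section CompleteSkeleton.
Variable G : sgraph.
Implicit Types (A B : {set G}) (P : {set {set G}}).

Definition complete_set A : bool :=
  [forall x in A, forall y in A, (x != y) ==> adj x y].

Definition joined A B : bool := [forall x in A, forall y in B, adj x y].

Definition unjoined A B : bool := [forall x in A, forall y in B, ~~ adj x y].

(* The library's partition also requires every part to be nonempty. *)
Definition complete_partition P : bool :=
  [&& partition P [set: G],
      [forall A in P, complete_set A] &
      [forall A in P, forall B in P, (A != B) ==> joined A B || unjoined A B]].

Definition complete_skeleton P : Prop :=
  complete_partition P /\
  forall Q : {set {set G}}, complete_partition Q -> (#|P| <= #|Q|)%N.

Lemma complete_skeleton_exists : exists P, complete_skeleton P.
Proof.
pose P0 : {set {set G}} := [set [set x] | x in [set: G]].
have P0P : complete_partition P0.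
  apply/and3P; split.
  - apply/and3P; split.
    + rewrite eqEsubset subsetT; apply/subsetP=> x _.
      apply/bigcupP; exists [set x]; last by rewrite inE.
      by apply/imsetP; exists x.
    + apply/trivIsetP=> _ _ /imsetP[x _ ->] /imsetP[y _ ->] nxy.
      by rewrite disjoints1 inE; apply: contraNN nxy => /eqP ->.
    + by apply/imsetP=> -[x _ /setP/(_ x)]; rewrite !inE eqxx.
  - apply/forall_inP=> _ /imsetP[x _ ->].
    apply/forall_inP=> y /set1P->; apply/forall_inP=> z /set1P->.
    by rewrite eqxx.
  - apply/forall_inP=> _ /imsetP[x _ ->]; apply/forall_inP=> _ /imsetP[y _ ->].
    apply/implyP=> _; case: (boolP (adj x y)) => xy; apply/orP; [left|right];
    by apply/forall_inP=> u /set1P->; apply/forall_inP=> v /set1P->.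
by case: (arg_minnP (fun P => #|P|) P0P) => P PP minP; exists P.
Qed.

Definition part P : finType := {A : {set G} | A \in P}.

Definition structure_adj P : rel (part P) :=
  fun C D => (C != D) && joined (val C) (val D).

Lemma structure_adj_sym P : symmetric (@structure_adj P).
Proof.
move=> C D; rewrite /structure_adj eq_sym; congr andb.
apply/idP/idP=> /forall_inP J; apply/forall_inP=> x xA; apply/forall_inP=> y yB;
by rewrite adj_sym; apply: (forall_inP (J y yB)).
Qed.

Lemma structure_adj_irr P : irreflexive (@structure_adj P).
Proof. by move=> C; rewrite /structure_adj eqxx. Qed.

Definition structure P : sgraph :=
  SGraph (@structure_adj_sym P) (@structure_adj_irr P).

End CompleteSkeleton.

(* Main.v *)
(** A real symmetric matrix [B = L *m M] of rank [r], factored through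
    dimension [r], satisfies [rank (B *m B) = r], so [M *m L] is invertible;
    Sylvester's determinant identity then exhibits 0 as a root of the
    characteristic polynomial of [B] of multiplicity exactly [n - r]. Applied
    to [B = 1 + A], this makes the multiplicity of -1 equal to
    [n - rank (1 + A)]. Finally [1 + A] has a 1 in position (x, y) exactly when
    the parts of x and y are equal or joined, so it arises from
    [1 + A(structure)] by repeating rows and columns, which preserves the
    rank. *)
Require Import Defs.
From mathcomp Require Import all_boot all_order all_algebra reals.

Set Implicit Arguments.
Unset Strict Implicit.
Unset Printing Implicit Defensive.

Import GRing.Theory.
Local Open Scope ring_scope.

(** Both sides equal [\det K * t ^+ n] for the block matrix [K] with rows [(t, L)] and [(M, 1)]: a
    column operation clears [M], while a row operation scaled by [t] makes [K] block triangular. No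
    division by [t] occurs, so [t] may be a polynomial. *)
Lemma sylvester_det (R : comNzRingType) (m n : nat) (t : R)
    (L : 'M[R]_(m, n)) (M : 'M[R]_(n, m)) :
  \det (t%:M - L *m M) * t ^+ n = t ^+ m * \det (t%:M - M *m L).
Proof.
pose K := block_mx t%:M L M (1%:M : 'M_n).
have detK : \det K = \det (t%:M - L *m M).
  have -> : \det K = \det (K *m block_mx 1%:M 0 (- M) 1%:M).
    by rewrite det_mulmx det_lblock !det1 !mulr1.
  rewrite mulmx_block !mulmx1 !mulmx0 !mul1mx mulmxN subrr !add0r.
  by rewrite det_ublock det1 mulr1.
rewrite -detK -[in LHS](det_scalar n) -[t ^+ m]det_scalar.
rewrite -(det_ublock t%:M L (t%:M - M *m L)).
have -> : \det (t%:M : 'M_n) = \det (block_mx 1%:M 0 (- M) t%:M : 'M_(m + n)).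
  by rewrite det_lblock det1 mul1r.
rewrite mulrC -det_mulmx mulmx_block !mul1mx !mul0mx !addr0 mulmx1.
by rewrite mulNmx mul_mx_scalar mul_scalar_mx addNr mulNmx addrC.
Qed.

(** If [u *m A *m A^T = 0], the squares of the entries of [u *m A] sum to 0, so [u *m A = 0]: the
    left kernels coincide. *)
Lemma mxrank_mul_tr (R : realFieldType) (m n : nat) (A : 'M[R]_(m, n)) :
  \rank (A *m A^T) = \rank A.
Proof.
apply/eqP; rewrite eqn_leq mxrankM_maxl /=.
suff kerA : (kermx (A *m A^T) <= kermx A)%MS.
  by move: (mxrankS kerA); rewrite !mxrank_ker leq_sub2lE ?rank_leq_row.
apply/row_subP=> i; apply/sub_kermxP; set u := row i _.
have : (u *m A) *m (u *m A)^T = 0.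
  rewrite trmx_mul mulmxA -(mulmxA u).
  by rewrite (sub_kermxP (row_sub i _)) mul0mx.
set v := u *m A; move/matrixP/(_ 0 0); rewrite !mxE.
under eq_bigr do rewrite [_^T _ _]mxE -expr2.
move=> sq0; apply/rowP=> j; rewrite [RHS]mxE.
apply/eqP; rewrite -sqrf_eq0; apply/eqP.
by apply: (Num.Theory.psumr_eq0P _ sq0) => // i' _; exact: Num.Theory.sqr_ge0.
Qed.

Lemma eigen_multiplicity_sym (R : realType) (n : nat) (A : 'M[R]_n) (a : R) :
  A^T = A -> (eigen_multiplicity A a + \rank (A - a%:M)%R = n)%N.
Proof.
move=> symA; set B := A - a%:M; set r := \rank B.
have symB : B^T = B by rewrite /B linearB /= symA tr_scalar_mx.
pose L := col_base B; pose M := row_base B.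
have LM : L *m M = B by exact: mulmx_base.
(* By symmetry [B *m B] has rank [r], and it factors through the [r] by [r] matrix [M *m L]. *)
have uML : M *m L \in unitmx.
  rewrite -row_free_unit /row_free eqn_leq rank_leq_row.
  have BB : B *m B = L *m (M *m L *m M) by rewrite -[in LHS]LM !mulmxA.
  rewrite -[leqLHS](mxrank_mul_tr B) symB BB.
  exact: leq_trans (mxrankM_maxr _ _) (mxrankM_maxl _ _).
pose q := \det (('X - a%:P)%:M - map_mx polyC (M *m L)).
(* Sylvester's identity at [t = 'X - a], since ['X - A = t - B]. *)
have charA : char_poly A * ('X - a%:P) ^+ r = ('X - a%:P) ^+ n * q.
  rewrite /q map_mxM -sylvester_det -map_mxM LM; congr (\det _ * _).
  rewrite /char_poly_mx /B map_mxB map_scalar_mx /= raddfB /=.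
  by rewrite opprB addrA subrK.
(* At [a] the polynomial [q] takes the value [\det (- (M *m L))], which is nonzero. *)
have qa : ~~ root q a.
  rewrite /root /q -horner_evalE -det_map_mx map_mxB map_scalar_mx /=.
  rewrite horner_evalE hornerXsubC subrr raddf0 sub0r.
  rewrite -map_mx_comp map_mx_id => [|x /=]; last by rewrite horner_evalE hornerC.
  by rewrite -unitfE -unitmxE -scaleN1r unitmxZ ?unitrN1.
have := congr1 (mup a) charA.
rewrite (mupMl _ qa) mupM ?monic_neq0 ?char_poly_monic ?monic_exp ?monicXsubC //.
by rewrite !mup_XsubCX eqxx.
Qed.

(** Selecting rows and columns never raises the rank, and selecting along the section [g] recovers
    [A] from [mxsub f f A]. *)
Lemma mxrank_mxsub_surj (F : fieldType) (m n : nat) (f : 'I_m -> 'I_n)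
    (g : 'I_n -> 'I_m) (A : 'M[F]_n) :
  cancel g f -> \rank (mxsub f f A) = \rank A.
Proof.
have rank_mxsub p q (h : 'I_p -> 'I_q) (C : 'M[F]_q) :
    (\rank (mxsub h h C) <= \rank C)%N.
  have rank_rowsub s t (D : 'M[F]_(s, t)) k (e : 'I_k -> 'I_s) :
      (\rank (rowsub e D) <= \rank D)%N by rewrite mxrankS ?rowsub_sub.
  rewrite mxsubrc (leq_trans (rank_rowsub _ _ _ _ _)) //.
  by rewrite -mxrank_tr trmx_mxsub -[leqRHS]mxrank_tr rank_rowsub.
move=> gK; apply/eqP; rewrite eqn_leq rank_mxsub /=.
have {1}-> : A = mxsub g g (mxsub f f A).
  by apply/matrixP=> i j; rewrite !mxE !gK.
exact: rank_mxsub.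
Qed.

Lemma mxrank_structure (R : realType) (G : sgraph) (P : {set {set G}}) :
  complete_partition P ->
  \rank (1%:M + adjmx R G)%R = \rank (1%:M + adjmx R (structure P))%R.
Proof.
case/and3P=> partP /forall_inP cplP /forall_inP joinP.
have [/eqP covP tiP nP0] := and3P partP.
have PP x : pblock P x \in P by rewrite pblock_mem // covP inE.
have xPx x : x \in pblock P x by rewrite mem_pblock covP inE.
pose part_of x : structure P := exist _ (pblock P x) (PP x).
have repP (C : structure P) : {x | x \in val C}.
  apply/sigW/set0Pn; apply: contraNneq nP0 => <-; exact: valP.
pose rep C := sval (repP C).
have repK : cancel rep part_of.
  move=> C; apply: val_inj; apply: def_pblock => //; first exact: valP.
  exact: svalP (repP C).
pose f (i : 'I_#|G|) := enum_rank (part_of (enum_val i)).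
pose g (i : 'I_#|structure P|) := enum_rank (rep (enum_val i)).
have gK : cancel g f by move=> i; rewrite /f /g enum_rankK repK enum_valK.
rewrite -(mxrank_mxsub_surj _ gK); congr (\rank _).
apply/matrixP=> i j; rewrite !mxE /f !enum_rankK (inj_eq enum_rank_inj).
rewrite -(inj_eq enum_val_inj); set x := enum_val i; set y := enum_val j.
rewrite /= /structure_adj -[part_of x == _]val_eqE /=.
have [eqxy|neqxy] := eqVneq x y; first by rewrite eqxy adj_irr eqxx.
(* Distinct vertices of one part are adjacent, so the 1 comes from adjacency on one side and from
   the diagonal on the other. *)
have [eqP|neqP] := eqVneq (pblock P x) (pblock P y).
  have /forall_inP/(_ x (xPx x))/forall_inP := cplP _ (PP x).
  by rewrite {1}eqP => /(_ y (xPx y)); rewrite neqxy /= => ->; rewrite addrC.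
congr (_ + _%:R); have /forall_inP/(_ _ (PP y)) := joinP _ (PP x).
rewrite neqP /= => /orP[J|U].
  by rewrite J (forall_inP (forall_inP J x (xPx x)) y (xPx y)).
(* The non-adjacent pair [x], [y] also shows that the two parts are not joined. *)
have /negPf nadj := forall_inP (forall_inP U x (xPx x)) y (xPx y).
rewrite nadj; congr nat_of_bool; apply/esym; apply: contraFF nadj => J.
exact: (forall_inP (forall_inP J x (xPx x)) y (xPx y)).
Qed.

Theorem theorem4p7 (R : realType) (Gamma : sgraph) (Omega : {set {set Gamma}})
    (k : nat) (hOmega : complete_skeleton Omega) :
  eigen_multiplicity (adjmx R Gamma) (-1) = k <->
  k%:Z = #|Gamma|%:Z - (\rank (1%:M + adjmx R (structure Omega))%R)%:Z.
Proof.
have symA : (adjmx R Gamma)^T = adjmx R Gamma.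
  by apply/matrixP=> i j; rewrite !mxE adj_sym.
have /(congr1 Posz) := eigen_multiplicity_sym (-1) symA.
rewrite raddfN /= opprK addrC (mxrank_structure R hOmega.1) PoszD => <-.
by rewrite addrK; split=> [->|[->]].
Qed.
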